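(* Let $\mathcal{H}$ be a real Hilbert space, let $M:\mathcal{H}\to\mathcal{H}$ be a cocoercive operator such that $S:=\operatorname{Zer}M=\{x\in\mathcal{H}:M(x)=0\}\neq\emptyset$, let $s_0>0$ and $\alpha>1$, and let $y:[s_0,+\infty[\to\mathcal{H}$ be a solution trajectory of $$\ddot y(s)+\frac{\alpha}{s}\dot y(s)+\frac{s}{\alpha+1}\frac{d}{ds}\left(M(y(s))\right)+M(y(s))=0.$$ Then the following statements are true: (i) $\|M(y(s))\|=o\left(\frac1s\right)$ as $s\to+\infty$; (ii) $\int_{s_0}^{+\infty}s\,\|M(y(s))\|^2ds<+\infty$; (iii) $y(s)$ converges weakly as $s\to+\infty$, and its limit belongs to $S$.
   Context: An operator $M:\mathcal{H}\to\mathcal{H}$ is cocoercive if there is $\rho>0$ such that $\langle M(x)-M(y),x-y\rangle\ge\rho\|M(x)-M(y)\|^2$ for all $x,y\in\mathcal{H}$. A solution trajectory is a function $y$ of class $\mathcal{C}^1$ on $[s_0,+\infty[$ such that $\dot y$ is locally absolutely continuous (then $s\mapsto M(y(s))$ is locally Lipschitz, hence also locally absolutely continuous) and the equation holds for almost every $s\ge s_0$. *)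

(* Defs.v *)
From HB Require Import structures.
From mathcomp Require Import all_boot all_order all_algebra.
From mathcomp Require Import all_classical all_reals all_analysis.

Set Implicit Arguments.
Unset Strict Implicit.
Unset Printing Implicit Defensive.

Import Order.TTheory GRing.Theory Num.Theory.
Import numFieldNormedType.Exports.

Local Open Scope classical_set_scope.
Local Open Scope ring_scope.

(* A real Hilbert space is a complete normed module [H] over [R] together with
   a positive definite symmetric bilinear form inducing its norm; for
   [theta = idfun], [{dot H for theta}] is the type of such forms. *)
Definition induces_norm (R : realType) (H : completeNormedModType R)
    (ip : {dot H for idfun}) : Prop :=
  forall x : H, ip x x = `|x| ^+ 2.

Definition cocoercive (R : realType) (H : completeNormedModType R)
    (ip : {dot H for idfun}) (M : H -> H) : Prop :=
  exists2 rho : R, 0 < rho &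
    forall x y : H, rho * `|M x - M y| ^+ 2 <= ip (M x - M y) (x - y).

Definition Zer (R : realType) (H : completeNormedModType R) (M : H -> H) :
  set H := [set x | M x = 0].

(* Required by Landau notations at [+oo]. *)
Canonical pinfty_filter_on (R : numFieldType) : filter_on R :=
  FilterType (pinfty_nbhs R) filter_filter.

(* Functions on the half-line [s0, +oo[ are represented by functions on [R]
   whose values before [s0] are irrelevant; the derivative at the endpoint
   [s0] is therefore the right derivative. *)
Definition C1_half_line (R : realType) (V : normedModType R) (s0 : R)
    (y v : R -> V) : Prop :=
  [/\ forall s : R, s0 < s -> is_derive s 1 y (v s),
      (h^-1 *: (y (s0 + h) - y s0)) @[h --> 0^'+] --> v s0
    & {within `[s0, +oo[, continuous v}].

Definition abs_continuous (R : realType) (V : normedModType R) (a b : R)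
    (f : R -> V) : Prop :=
  forall e : R, 0 < e -> exists2 d : R, 0 < d &
    forall (n : nat) (l r : 'I_n -> R),
      (forall i, [/\ a <= l i, l i <= r i & r i <= b]) ->
      trivIset [set: 'I_n] (fun i => `]l i, r i[%classic) ->
      \sum_(i < n) (r i - l i) < d ->
      \sum_(i < n) `|f (r i) - f (l i)| < e.

Definition loc_abs_continuous (R : realType) (V : normedModType R) (s0 : R)
    (f : R -> V) : Prop :=
  forall a b : R, s0 <= a -> abs_continuous a b f.

(* [v] is the first derivative of [y]. That the equation holds at [s] includes
   that [v] and [M \o y] are differentiable at [s], with derivatives [a] and
   [w]; the endpoint [s0], a null set, is left out. *)
Definition solution_trajectory (R : realType) (H : completeNormedModType R)
    (M : H -> H) (alpha s0 : R) (y : R -> H) : Prop :=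
  exists v : R -> H,
  [/\ C1_half_line s0 y v,
      loc_abs_continuous s0 v
    & {ae (@lebesgue_measure R), forall s : R, s0 < s ->
        exists a w : H,
        [/\ is_derive s 1 v a,
            is_derive s 1 (M \o y) w
          & a + (alpha / s) *: v s + (s / (alpha + 1)) *: w + M (y s) = 0]}].

(* The weak topology of a Hilbert space is the coarsest one making all the
   functions [ip ^~ u] continuous. *)
Definition weakly_cvg (R : realType) (H : completeNormedModType R)
    (ip : {dot H for idfun}) (y : R -> H) (x : H) : Prop :=
  forall u : H, ip (y s) u @[s --> +oo] --> ip x u.

(* Main.v *)
Require Import Defs.
From HB Require Import structures.
From mathcomp Require Import all_boot all_order all_algebra.
From mathcomp Require Import all_classical all_reals all_analysis.
From mathcomp Require Import measurable_realfun ring lra.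

Import Order.TTheory GRing.Theory Num.Theory.
Import numFieldNormedType.Exports.

Local Open Scope classical_set_scope.
Local Open Scope ring_scope.

(** The equation integrates once. With c = 1/(alpha + 1), the function
    p(s) = y'(s) + c s M(y(s)) satisfies p' + (alpha/s) p = 0 almost everywhere,
    because c (alpha + 1) = 1 turns the left-hand side into that of the equation.
    Hence s^alpha p(s), which is locally absolutely continuous, is a constant C,
    and the trajectory obeys a first-order equation ([first_integral]):

      y'(s) = s^(-alpha) C - c s M(y(s)),

    a steepest descent for M, in rescaled time, with a perturbation that is
    integrable since alpha > 1. Everything else is the analysis of this flow.

    - Let z be a zero of M. Cocoercivity gives <M(y), y - z> >= rho |M(y)|^2, so
      |y - z|^2 decreases at least at the rate 2 c rho s |M(y)|^2, up to the
      effect of the perturbation.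
      Multiplying 1 + |y - z|^2 by exp(theta), where theta' = -|C| s^(-alpha),
      absorbs the perturbation: the product is nonincreasing and nonnegative
      ([dlyapunov_le]), so |y - z| converges ([sqr_dist_is_cvg]), and the
      integral of s |M(y)|^2 is finite ([residual_integral_lty]).
    - Cocoercivity differentiated along the trajectory says that
      <(M(y))', y'> >= rho |(M(y))'|^2. With the first-order equation this bounds
      (|M(y)|^2)' above by a multiple of s^(-2 alpha - 1), so |M(y)| is almost
      nonincreasing. Hence |M(y(s))|^2 is controlled by its value at a point of
      [s/2, s] where, by the mean value theorem, it is controlled by the decrease
      of the Lyapunov function over [s/2, s]; this decrease tends to 0, and
      s |M(y(s))| tends to 0 ([residual_sqr_decay]).
    - Since M(y(s)) tends to 0, every weak limit point of y is a zero of M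
      ([cocoercive_demiclosed]), and Opial's argument ([opial]) gives weak
      convergence. Weak limit points are taken along ultrafilters, and the Riesz
      representation theorem is obtained by minimizing a quadratic functional.

    Two facts of real analysis carry the passage from almost everywhere to
    everywhere: an absolutely continuous function whose derivative is nonpositive
    almost everywhere is nonincreasing ([abs_continuous_ae_nonincreasing]), and
    absolute continuity is inherited by dominated increments
    ([abs_continuous_dominated]). *)

(** * Absolutely continuous functions *)

Section AbsoluteContinuity.
Context {R : realType}.
Local Notation mu := (@lebesgue_measure R).

(** The supremum of the points of [a, b] where P holds cannot lie before b, since
    a step across it would go beyond it. The step goes from the left of x to its
    right in one move, so that it needs only a local property at x. *)
Lemma cousin_induction (P : R -> Prop) (a b : R) : a <= b -> P a ->
  (forall x, a <= x -> x <= b -> exists2 r : R, 0 < r &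
     forall t t', a <= t -> t <= x -> x <= t' -> t' <= b ->
       x - r < t -> t' < x + r -> P t -> P t') ->
  P b.
Proof.
move=> ab Pa step.
pose A := [set t | [/\ a <= t, t <= b & P t]].
have Aa : A a by split.
have supA : has_sup A by split; [exists a | exists b => t []].
have ax : a <= sup A by exact: sup_upper_bound.
have xb : sup A <= b by apply: ge_sup => [|t []//]; exists a.
have [r r0 Pr] := step _ ax xb.
have [t [at_ tb Pt] xt] := sup_adherent r0 supA.
have tx : t <= sup A by exact: sup_upper_bound.
pose t' := Num.min b (sup A + r / 2).
have xt' : sup A <= t' by rewrite /t' le_min xb/= lerDl divr_ge0// ltW.
have t'b : t' <= b by rewrite /t' ge_min lexx.
have Pt' : P t'.
  apply: (Pr t) => //; apply: (@le_lt_trans _ _ (sup A + r / 2)).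
    by rewrite /t' ge_min lexx orbT.
  by rewrite ltrD2l; lra.
have /(sup_upper_bound supA) : A t' by split => //; exact: le_trans ax xt'.
rewrite /t'; case: (leP b (sup A + r / 2)) => [bx _|_]; last by lra.
by move: Pt'; rewrite /t' min_l.
Qed.

Lemma sum_disjoint_itv_le (U : set R) n (l r : 'I_n -> R) :
  measurable U -> (forall i, l i <= r i) ->
  (forall i, `]l i, r i[%classic `<=` U) ->
  trivIset [set: 'I_n] (fun i => `]l i, r i[%classic) ->
  ((\sum_(i < n) (r i - l i))%:E <= mu U)%E.
Proof.
move=> mU lr sU tI.
have mF (i : 'I_n) : measurable `]l i, r i[%classic by [].
have -> : ((\sum_(i < n) (r i - l i))%:E =
    mu (\big[setU/set0]_(i < n) `]l i, r i[%classic))%E.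
  rewrite measure_bigsetU_ord// -sumEFin; apply: eq_bigr => i _.
  apply/esym; transitivity (mu `]l i, r i[%classic) => //.
  rewrite lebesgue_measure_itv/= lte_fin; case: ltP => //= rl.
  by rewrite (@le_anti _ _ (l i) (r i)) ?subrr// lr rl.
apply: le_measure; rewrite ?inE//; first by apply: bigsetU_measurable.
by elim/big_ind : _ => [|A B AU BU|i _]; [exact: sub0set|rewrite subUset|exact: sU].
Qed.

(** The exceptional set is covered by an open set U of small measure, and the
    interval [a, b] is crossed by small steps: around a point outside U the slope
    of g is at most e; around a point of U the step stays inside U. The steps of
    the second kind are disjoint and have a small total length, so absolute
    continuity bounds their contribution. A chain of steps, given by
    [cousin_induction], replaces a Vitali covering. *)
Lemma abs_continuous_ae_nonincreasing (a b : R) (g : R -> R) : a <= b ->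
  abs_continuous a b g ->
  {ae mu, forall s : R, a < s -> s < b ->
     exists2 d : R, is_derive s 1 g d & d <= 0} ->
  g b <= g a.
Proof.
move=> ab acg [N [mN N0 sN]].
apply/ler_addgt0Pr => e0 e00.
(* The slopes contribute e * (b - a), the steps inside U contribute e. *)
pose e := e0 / (b - a + 1).
have e_gt0 : 0 < e by rewrite divr_gt0//; lra.
have [d d0 acd] := acg e e_gt0.
(* The endpoints join the exceptional set, for want of a derivative there. *)
pose N' := N `|` [set a; b].
have mN' : measurable N' by apply: measurableU => //; apply: measurableU.
have N'0 : mu N' = 0.
  apply/eqP; rewrite -measure_le0.
  have -> : 0%E = (mu N + (mu [set a] + mu [set b]))%E.
    by rewrite [mu N]N0 !lebesgue_measure_set1 !adde0.
  apply: (le_trans (measureU2 _ _ _)) => //; first exact: measurableU.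
  by apply: leeD => //; apply: measureU2.
have [|U [oU sU mU]] := lebesgue_regularity_outer (D := N') (eps := d) mN' _ d0.
  by rewrite [X in (X < _)%E]N'0 ltry.
have mUm : measurable U by exact: open_measurable.
have mUd : (mu U < d%:E)%E.
  apply: (@le_lt_trans _ _ (mu N' + mu (U `\` N'))%E); last first.
    by rewrite [mu N']N'0 add0e.
  rewrite -{1}(setDUK sU); apply: measureU2 => //; exact: measurableD.
(* The list s holds the steps made inside U so far, the latest one first. *)
pose P t := exists s : seq (R * R),
  [/\ forall p, p \in s -> [/\ a <= p.1, p.1 <= p.2, p.2 <= t & `]p.1, p.2[%classic `<=` U],
      pairwise (fun p q => q.2 <= p.1) s &
      g t - g a <= e * (t - a) + \sum_(p <- s) (g p.2 - g p.1)].
have : P b.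
  apply: (@cousin_induction _ a b) => //.
    by exists [::]; split => //; rewrite big_nil !subrr mulr0 addr0.
  move=> x ax xb.
  have [Ux|nUx] := pselect (U x).
    have /nbhs_ballP[r /= r0 rU] : nbhs x U by exact: open_nbhs_nbhs.
    exists r => // t t' at_ tx xt' t'b xrt t'xr [s [s1 s2 s3]].
    exists ((t, t') :: s); split.
    - move=> p; rewrite inE => /predU1P[->/=|ps].
        split => //; first exact: le_trans xt'.
        move=> z /=; rewrite in_itv/= => /andP[tz zt']; apply: rU.
        by rewrite /ball/= ltr_distlC; apply/andP; split; lra.
      have [? ? pt ?] := s1 _ ps; split => //.
      by apply: (le_trans pt); exact: le_trans xt'.
    - by rewrite /= s2 andbT; apply/allP => p /s1[].
    - rewrite big_cons/=.
      have : e * (t - a) <= e * (t' - a) by rewrite ler_pM2l//; lra.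
      lra.
  have xa : a < x.
    by rewrite lt_neqAle ax andbT; apply/eqP => xa; apply/nUx/sU; right; left.
  have bx : x < b.
    by rewrite lt_neqAle xb andbT; apply/eqP => xb'; apply/nUx/sU; right; right.
  have [k dk k0] : exists2 d : R, is_derive x 1 g d & d <= 0.
    apply: contrapT => nd; apply/nUx/sU; left; apply: sN => /= h.
    exact/nd/h.
  have q : (fun h => h^-1 *: (g (h *: 1 + x) - g x)) @ 0^' --> k.
    by case: dk => df <-; exact: df.
  have : \forall h \near (0:R)^', h^-1 * (g (h + x) - g x) < e.
    have hq := @cvgr_lt _ _ _ (dnbhs_filter (0:R)) _ _ q _ (le_lt_trans k0 e_gt0).
    by apply: filterS hq => h; rewrite /GRing.scale/= mulr1.
  rewrite near_withinE => /nbhs_ballP[r /= r0 rq].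
  exists r => // t t' at_ tx xt' t'b xrt t'xr [s [s1 s2 s3]].
  have t'x : g t' - g x <= e * (t' - x).
    move: xt'; rewrite le_eqVlt => /predU1P[->|xt']; first by rewrite !subrr mulr0.
    have /rq : ball 0 r (t' - x) by rewrite /ball/= sub0r normrN gtr0_norm; lra.
    rewrite subrK mulrC ltr_pdivrMr ?subr_gt0// => h; apply/ltW/h.
    by rewrite gt_eqF// subr_gt0.
  have tx' : g x - g t <= e * (x - t).
    move: tx; rewrite le_eqVlt => /predU1P[->|tx]; first by rewrite !subrr mulr0.
    have /rq : ball 0 r (t - x) by rewrite /ball/= sub0r normrN ltr0_norm; lra.
    rewrite subrK -mulrNN -invrN mulrC !opprB ltr_pdivrMr ?subr_gt0// => h; apply/ltW/h.
    by rewrite lt_eqF// subr_lt0.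
  exists s; split => // [p /s1[? ? pt ?]|]; last lra.
  by split => //; apply: (le_trans pt); exact: le_trans xt'.
move=> [s [s1 s2 s3]].
pose l (i : 'I_(size s)) := (nth (a, a) s i).1.
pose r (i : 'I_(size s)) := (nth (a, a) s i).2.
have si (i : 'I_(size s)) := s1 _ (mem_nth (a, a) (ltn_ord i)).
have tI : trivIset [set: 'I_(size s)] (fun i => `]l i, r i[%classic).
  have dis (i j : 'I_(size s)) z : (i < j)%N ->
      `]l i, r i[%classic z -> `]l j, r j[%classic z -> False.
    move=> ij; have /(pairwiseP (a, a))/(_ i j (ltn_ord i) (ltn_ord j) ij) := s2.
    rewrite /= !in_itv/= -/(r j) -/(l i) => rl /andP[h1 _] /andP[_ h2]; lra.
  move=> i j _ _ [z [zi zj]]; apply/val_inj.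
  by case: (ltngtP i j) => // ij; [case: (dis _ _ _ ij zi zj)|case: (dis _ _ _ ij zj zi)].
have := acd _ l r _ tI.
have sumd : \sum_(i < size s) (r i - l i) < d.
  rewrite -lte_fin; apply: le_lt_trans mUd; apply: sum_disjoint_itv_le => //.
    by move=> i; case: (si i).
  by move=> i; case: (si i).
have lrb i : [/\ a <= l i, l i <= r i & r i <= b] by case: (si i).
move=> /(_ lrb sumd) acs.
have : \sum_(p <- s) (g p.2 - g p.1) <= e.
  rewrite (big_nth (a, a)) big_mkord; apply: le_trans (ltW acs).
  by apply: ler_sum => i _; exact: ler_norm.
have : e * (b - a + 1) = e0 by rewrite divfK// gt_eqF//; lra.
lra.
Qed.

(** A common source for the closure properties of absolute continuity: sums,
    products of bounded functions, Lipschitz functions and inner products. *)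
Lemma abs_continuous_dominated {V V1 V2 : normedModType R} (a b K L : R)
    (f : R -> V) (f1 : R -> V1) (f2 : R -> V2) : 0 <= K -> 0 <= L ->
  abs_continuous a b f1 -> abs_continuous a b f2 ->
  (forall l r, a <= l -> l <= r -> r <= b ->
     `|f r - f l| <= K * `|f1 r - f1 l| + L * `|f2 r - f2 l|) ->
  abs_continuous a b f.
Proof.
move=> K0 L0 ac1 ac2 dom e e0.
pose e' := e / (K + L + 1).
have KL : 0 < K + L + 1 by lra.
have e'0 : 0 < e' by rewrite divr_gt0.
have [d1 d10 {}ac1] := ac1 _ e'0; have [d2 d20 {}ac2] := ac2 _ e'0.
exists (Num.min d1 d2); first by rewrite lt_min d10.
move=> n l r lr tI; rewrite lt_min => /andP[s1 s2].
have {}ac1 := ac1 _ _ _ lr tI s1; have {}ac2 := ac2 _ _ _ lr tI s2.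
apply: (@le_lt_trans _ _ (K * e' + L * e')); last first.
  have : e' * (K + L + 1) = e by rewrite divfK// gt_eqF.
  lra.
apply: (@le_trans _ _ (\sum_(i < n)
    (K * `|f1 (r i) - f1 (l i)| + L * `|f2 (r i) - f2 (l i)|))).
  by apply: ler_sum => i _; case: (lr i) => ? ? ?; exact: dom.
by rewrite big_split/= -!mulr_sumr; apply: lerD; apply: ler_wpM2l => //; exact: ltW.
Qed.

Lemma abs_continuous_id (a b : R) : abs_continuous a b (id : R -> R).
Proof.
move=> e e0; exists e => // n l r lr _; apply: le_lt_trans.
by apply: ler_sum => i _; case: (lr i) => _ h _; rewrite ger0_norm// subr_ge0.
Qed.

Lemma lipschitz_abs_continuous {V : normedModType R} (a b K : R) (f : R -> V) : 0 <= K ->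
  (forall l r, a <= l -> l <= r -> r <= b -> `|f r - f l| <= K * (r - l)) ->
  abs_continuous a b f.
Proof.
move=> K0 lip; apply: (@abs_continuous_dominated V R R a b K 0 f id id) => //;
  try exact: abs_continuous_id.
move=> l r al lr rb; rewrite mul0r addr0 [X in K * X]ger0_norm ?subr_ge0//.
exact: lip.
Qed.

Lemma abs_continuousD {V : normedModType R} (a b : R) (f g : R -> V) :
  abs_continuous a b f -> abs_continuous a b g ->
  abs_continuous a b (fun s => f s + g s).
Proof.
move=> acf acg; apply: (@abs_continuous_dominated _ _ _ a b 1 1 _ f g) => // l r _ _ _.
by rewrite !mul1r opprD addrACA ler_normD.
Qed.

Lemma abs_continuousM (a b K L : R) (f g : R -> R) :
  (forall s, a <= s -> s <= b -> `|f s| <= K) ->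
  (forall s, a <= s -> s <= b -> `|g s| <= L) ->
  abs_continuous a b f -> abs_continuous a b g ->
  abs_continuous a b (fun s => f s * g s).
Proof.
move=> fK gL acf acg.
have [ab|ba] := leP a b; last first.
  apply: (@lipschitz_abs_continuous _ _ _ 0) => // l r al lr rb.
  by have := le_trans al (le_trans lr rb); lra.
have K0 : 0 <= K by apply: le_trans (fK a (lexx _) ab).
have L0 : 0 <= L by apply: le_trans (gL a (lexx _) ab).
apply: (@abs_continuous_dominated _ _ _ a b L K _ f g) => // l r al lr rb.
have -> : f r * g r - f l * g l = (f r - f l) * g l + f r * (g r - g l) by ring.
apply: (le_trans (ler_normD _ _)); rewrite !normrM [L * _]mulrC.
apply: lerD; [apply: ler_wpM2l => //|apply: ler_wpM2r => //].
  by apply: gL => //; exact: le_trans rb.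
by apply: fK => //; exact: le_trans lr.
Qed.

End AbsoluteContinuity.

(** * Real functions *)

Section RealFunctions.
Context {R : realType}.

Lemma is_derive_mul (f g : R -> R) (t a b : R) :
  is_derive t 1 f a -> is_derive t 1 g b ->
  is_derive t (1:R) (fun s => f s * g s : R) (a * g t + f t * b).
Proof.
move=> df dg; have := is_deriveM df dg.
by rewrite /GRing.scale/= addrC [g t * a]mulrC.
Qed.

Lemma is_derive_add (f g : R -> R) (t a b : R) :
  is_derive t 1 f a -> is_derive t 1 g b ->
  is_derive t (1:R) (fun s => f s + g s : R) (a + b).
Proof. by move=> df dg; exact: is_deriveD df dg. Qed.

Lemma is_derive_mul_cst (f : R -> R) (t a c : R) :
  is_derive t 1 f a -> is_derive t (1:R) (fun s => c * f s : R) (c * a).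
Proof. by move=> df; exact: is_deriveZ df. Qed.

Lemma segment_bounded {V : normedModType R} (a b : R) (f : R -> V) : a <= b ->
  (forall s, a <= s -> s <= b -> {for s, continuous f}) ->
  exists B, forall s, a <= s -> s <= b -> `|f s| <= B.
Proof.
move=> ab cf; have [|c _ fc] := @EVT_max R (fun s => `|f s|) a b ab.
  apply: continuous_in_subspaceT => s; rewrite inE/= in_itv/= => /andP[as_ sb].
  by apply: cvg_norm; exact: cf.
by exists `|f c| => s as_ sb; apply: fc; rewrite in_itv/= as_.
Qed.

Lemma is_derive_continuous {V : normedModType R} (f : R -> V) (s : R) d :
  is_derive s 1 f d -> {for s, continuous f}.
Proof. by case=> df _; apply: differentiable_continuous; apply/derivable1_diffP. Qed.

Lemma is_derive_lipschitz (a b K : R) (f df : R -> R) :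
  (forall s, a <= s -> s <= b -> is_derive s 1 f (df s)) ->
  (forall s, a <= s -> s <= b -> `|df s| <= K) ->
  forall l r, a <= l -> l <= r -> r <= b -> `|f r - f l| <= K * (r - l).
Proof.
move=> dfE dfK l r al; rewrite le_eqVlt => /predU1P[->|lr] rb.
  by rewrite !subrr normr0 mulr0.
have [||c] := @MVT R f df l r lr.
- by move=> x; rewrite in_itv/= => /andP[? ?]; apply: dfE; lra.
- apply: continuous_in_subspaceT => s; rewrite inE/= in_itv/= => /andP[as_ sb].
  by apply: (@is_derive_continuous _ _ _ (df s)); apply: dfE; lra.
rewrite in_itv/= => /andP[lc cr] ->; rewrite normrM (gtr0_norm (_ : 0 < r - l)) ?subr_gt0//.
by apply: ler_wpM2r; [rewrite subr_ge0 ltW|apply: dfK; lra].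
Qed.

Lemma powR_lipschitz (p a b : R) : 0 < a -> a <= b -> exists2 K, 0 <= K &
  forall l r, a <= l -> l <= r -> r <= b -> `|r `^ p - l `^ p| <= K * (r - l).
Proof.
move=> a0 ab.
have [|B hB] := @segment_bounded R a b (fun s => p * s `^ (p - 1)) ab.
  move=> s as_ _; apply: (@is_derive_continuous _ _ _ (p * ((p - 1) * s `^ (p - 1 - 1)))).
  by apply: is_derive_mul_cst; apply: is_derive1_powR; exact: lt_le_trans as_.
exists B; first by apply: le_trans (hB a (lexx a) ab).
move=> l r al lr rb.
refine (is_derive_lipschitz a b B (fun s => s `^ p) (fun s => p * s `^ (p - 1))
  _ hB l r al lr rb) => s as_ _.
by apply: is_derive1_powR; exact: lt_le_trans as_.
Qed.

Lemma powR_continuous (p s : R) : 0 < s -> x `^ p @[x --> s] --> s `^ p.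
Proof.
by move=> s_gt0; apply: (is_derive_continuous (fun x => x `^ p) _ _ (is_derive1_powR p s_gt0)).
Qed.

Lemma powRN_cvg0 (p : R) : 0 < p -> (x `^ (- p)) @[x --> +oo] --> (0 : R).
Proof.
move=> p0; apply/cvgrPdist_le => e e0; near=> x.
have x0 : 0 < x by near: x; apply: nbhs_pinfty_gt; exact: num_real.
rewrite sub0r normrN ger0_norm ?powR_ge0// powRN.
rewrite invf_ple ?posrE ?powR_gt0//.
have ex : e^-1 `^ p^-1 <= x by near: x; apply: nbhs_pinfty_ge; exact: num_real.
have -> : e^-1 = (e^-1 `^ p^-1) `^ p.
  by rewrite -powRrM mulVf ?gt_eqF// powRr1// invr_ge0 ltW.
by apply: ge0_ler_powR; rewrite ?nnegrE ?powR_ge0// ltW.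
Unshelve. all: by end_near. Qed.

Lemma nonincreasing_bounded_cvg (a m : R) (f : R -> R) :
  (forall s t, a < s -> s <= t -> f t <= f s) -> (forall s, a < s -> m <= f s) ->
  exists l : R, f x @[x --> +oo] --> l.
Proof.
move=> fdec fm.
(* Clamping the argument at a + 1 gives a function monotone on the whole line. *)
pose F s := - f (Num.max s (a + 1)).
have am (s : R) : a < Num.max s (a + 1) by rewrite lt_max ltrDl ltr01 orbT.
have Fnd : nondecreasing_fun F.
  by move=> s t st; rewrite /F lerN2; apply: fdec => //;
    rewrite ge_max le_max st/= le_max lexx orbT.
have Fub : has_ubound (range F).
  by exists (- m) => _ [s _ <-]; rewrite /F lerN2; exact: fm.
have := nondecreasing_cvgr Fnd Fub; set l := sup _ => /cvgN Fl.
exists (- l); apply: cvg_trans Fl; apply: near_eq_cvg; near=> s.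
rewrite /F /= opprK max_l//; near: s; apply: nbhs_pinfty_ge; exact: num_real.
Unshelve. all: by end_near. Qed.

Lemma is_derive_right_cvg {V : normedModType R} (f : R -> V) (a : R) (d : V) :
  (h^-1 *: (f (a + h) - f a)) @[h --> 0^'+] --> d -> f x @[x --> a^'+] --> f a.
Proof.
move=> fd.
have h0 : (h *: (h^-1 *: (f (a + h) - f a))) @[h --> 0^'+] --> (0 : R) *: d.
  by apply: cvgZ => //; apply: cvg_at_right_filter; exact: cvg_id.
rewrite scale0r in h0.
apply/cvgrPdist_lt => e e0; apply/nbhs_right0P; near=> h.
have h_gt0 : 0 < h by near: h; exact: nbhs_right_gt.
have : `|0 - h *: (h^-1 *: (f (a + h) - f a))| < e.
  by near: h; apply: cvgr_dist_lt.
by rewrite scalerA mulfV ?gt_eqF// scale1r sub0r normrN distrC.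
Unshelve. all: by end_near. Qed.

End RealFunctions.

(** * Inner products *)

Section InnerProduct.
Context {R : realType} {H : completeNormedModType R} (ip : {dot H for idfun}).

Lemma ipC (x y : H) : ip x y = ip y x.
Proof. by rewrite hermitian_subproof expr0 mul1r. Qed.

Lemma ipDl (x y z : H) : ip (x + y) z = ip x z + ip y z.
Proof. exact: linearDl. Qed.

Lemma ipDr (x y z : H) : ip z (x + y) = ip z x + ip z y.
Proof. by rewrite linearDr. Qed.

Lemma ipNl (x z : H) : ip (- x) z = - ip x z.
Proof. exact: linearNl. Qed.

Lemma ipNr (x z : H) : ip z (- x) = - ip z x.
Proof. exact: linearNr. Qed.

Lemma ipZl (a : R) (x z : H) : ip (a *: x) z = a * ip x z.
Proof. exact: linearZl_LR. Qed.

Lemma ipZr (a : R) (x z : H) : ip z (a *: x) = a * ip z x.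
Proof. exact: linearZr_LR. Qed.

Lemma ip0r (x : H) : ip x 0 = 0.
Proof. by rewrite -(scale0r (0 : H)) ipZr mul0r. Qed.

Hypothesis ip_norm : induces_norm ip.

Lemma normD_sqr (x y : H) : `|x + y| ^+ 2 = `|x| ^+ 2 + ip x y *+ 2 + `|y| ^+ 2.
Proof. rewrite -!ip_norm ipDl !ipDr (ipC y x); ring. Qed.

Lemma normB_sqr (x y : H) : `|x - y| ^+ 2 = `|x| ^+ 2 - ip x y *+ 2 + `|y| ^+ 2.
Proof. by rewrite normD_sqr ipNr normrN mulNrn. Qed.

(** Cauchy-Schwarz is read off the triangle inequality for the given norm, by
    expanding the square of the norm of x + y. *)
Lemma ip_le (x y : H) : ip x y <= `|x| * `|y|.
Proof.
have : `|x + y| ^+ 2 <= (`|x| + `|y|) ^+ 2.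
  by rewrite ler_sqr ?nnegrE ?addr_ge0// ler_normD.
rewrite normD_sqr; lra.
Qed.

Lemma norm_ip_le (x y : H) : `|ip x y| <= `|x| * `|y|.
Proof. by rewrite ler_norml lerNl -ipNl -(normrN x) ip_le normrN ip_le. Qed.

Lemma cvg_ip {T : Type} (F : set_system T) {FF : Filter F} (f g : T -> H) a b :
  f @ F --> a -> g @ F --> b -> (ip (f x) (g x)) @[x --> F] --> ip a b.
Proof.
move=> fa gb.
have : (`|f x - a| * `|g x - b| + (`|f x - a| * `|b| + `|a| * `|g x - b|))
    @[x --> F] --> (0 : R).
  have fa0 : `|f x - a| @[x --> F] --> (0:R).
    by rewrite -(normr0 H) -(subrr a); apply: cvg_norm; apply: cvgB => //; exact: cvg_cst.
  have gb0 : `|g x - b| @[x --> F] --> (0:R).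
    by rewrite -(normr0 H) -(subrr b); apply: cvg_norm; apply: cvgB => //; exact: cvg_cst.
  rewrite -[0 in X in _ --> X](_ : 0 * 0 + (0 * `|b| + `|a| * 0) = 0); last by ring.
  apply: cvgD; first exact: cvgM.
  by apply: cvgD; apply: cvgM => //; exact: cvg_cst.
move=> h0; apply/subr_cvg0; apply: norm_cvg0.
apply: (squeeze_cvgr (f := cst 0) _ _ h0); last exact: cvg_cst.
near=> x; rewrite normr_ge0/=.
have -> : ip (f x) (g x) - ip a b = ip (f x - a) (g x - b) + (ip (f x - a) b + ip a (g x - b)).
  rewrite !(ipDl,ipDr,ipNl,ipNr); ring.
apply: (le_trans (ler_normD _ _)); apply: lerD; first exact: norm_ip_le.
by apply: (le_trans (ler_normD _ _)); apply: lerD; exact: norm_ip_le.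
Unshelve. all: by end_near. Qed.

Lemma is_derive_ip (f g : R -> H) (t : R) a b :
  is_derive t 1 f a -> is_derive t 1 g b ->
  is_derive t (1:R) (fun s => ip (f s) (g s) : R) (ip a (g t) + ip (f t) b).
Proof.
move=> df dg.
have cg : g x @[x --> t] --> g t.
  by apply: differentiable_continuous; apply/derivable1_diffP; case: dg.
have qf : (fun h => h^-1 *: (f (h *: 1 + t) - f t)) @ 0^' --> a.
  by case: df => df <-; exact: df.
have qg : (fun h => h^-1 *: (g (h *: 1 + t) - g t)) @ 0^' --> b.
  by case: dg => dg <-; exact: dg.
have key : (fun h => h^-1 *:
    (ip (f (h *: 1 + t)) (g (h *: 1 + t)) - ip (f t) (g t))) @ 0^' -->
    ip a (g t) + ip (f t) b.
  have cg' : (fun h => g (h *: (1:R) + t)) @ 0^' --> g t.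
    apply: (@cvg_comp _ _ _ (fun h : R => h *: (1:R) + t) g _ (nbhs t)); last exact: cg.
    have -> : nbhs t = nbhs (0 *: (1:R) + t) by rewrite scale0r add0r.
    apply: (cvg_trans (G := (fun h : R => h *: (1:R) + t) @ nbhs 0)).
      by apply: cvg_app; exact: nbhs_dnbhs.
    by apply: cvgD; [apply: cvgZr_tmp; exact: cvg_id|exact: cvg_cst].
  have : (fun h => ip (h^-1 *: (f (h *: 1 + t) - f t)) (g (h *: (1:R) + t)) +
      ip (f t) (h^-1 *: (g (h *: 1 + t) - g t))) @ 0^' -->
      ip a (g t) + ip (f t) b.
    by apply: cvgD; apply: cvg_ip => //; exact: cvg_cst.
  apply: cvg_trans; apply: near_eq_cvg; near=> h.
  rewrite !(ipDl,ipDr,ipNl,ipNr,ipZl,ipZr) /GRing.scale/=; ring.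
apply: DeriveDef; first exact: (cvgP _ key).
exact: (cvg_lim _ key).
Unshelve. all: by end_near. Qed.

Lemma is_derive_ip_cst (f : R -> H) (t : R) a h :
  is_derive t 1 f a -> is_derive t (1:R) (fun s => ip (f s) h : R) (ip a h).
Proof.
move=> df; rewrite -[ip a h]addr0 -(ip0r (f t)).
by apply: is_derive_ip => //; exact: is_derive_cst.
Qed.

(** Testing f against its own increment reduces the mean value inequality to the
    real-valued one. *)
Lemma is_derive_lipschitz_ip (a b K : R) (f df : R -> H) :
  (forall s, a <= s -> s <= b -> is_derive s 1 f (df s)) ->
  (forall s, a <= s -> s <= b -> `|df s| <= K) ->
  forall l r, a <= l -> l <= r -> r <= b -> `|f r - f l| <= K * (r - l).
Proof.
move=> dfE dfK l r al lr rb.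
set h := f r - f l; have [->|h0] := eqVneq h 0.
  rewrite normr0 mulr_ge0 ?subr_ge0//.
  by apply: le_trans (dfK l al (le_trans lr rb)).
have -> // : `|h| <= K * (r - l).
rewrite -(ler_pM2r (_ : 0 < `|h|)) ?normr_gt0// -expr2 -(ip_norm h).
rewrite {1}/h ipDl ipNl.
apply: (le_trans (ler_norm _)); rewrite mulrAC.
apply: (is_derive_lipschitz a b (K * `|h|) (fun s => ip (f s) h)
  (fun s => ip (df s) h)) => // s as_ sb.
  by apply: is_derive_ip_cst; exact: dfE.
by apply: (le_trans (norm_ip_le _ _)); apply: ler_wpM2r => //; exact: dfK.
Qed.

Lemma abs_continuous_ip a b (f : R -> H) h : abs_continuous a b f ->
  abs_continuous a b (fun s => ip (f s) h : R).
Proof.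
move=> acf; apply: (@abs_continuous_dominated _ _ _ _ a b `|h| 0 _ f f) => // l r _ _ _.
by rewrite mul0r addr0 -ipNl -ipDl mulrC norm_ip_le.
Qed.

(** * Weak limits *)

Lemma parallelogram (x y : H) : `|x - y| ^+ 2 + `|x + y| ^+ 2 = 2 * `|x| ^+ 2 + 2 * `|y| ^+ 2.
Proof. by rewrite normB_sqr normD_sqr; ring. Qed.

(** The representing vector minimizes J x = |x|^2 - 2 l(x). The parallelogram law
    makes minimizing sequences Cauchy, and the first-order condition at the
    minimum is the representation formula. *)
Lemma riesz_representation (l : H -> R) (B : R) :
  (forall a x y, l (a *: x + y) = a * l x + l y) ->
  (forall x, `|l x| <= B * `|x|) ->
  exists x, forall u, ip x u = l u.
Proof.
move=> lin bnd.
have l0 : l 0 = 0.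
  by apply/normr0_eq0/le_anti; rewrite normr_ge0 andbT (le_trans (bnd 0))// normr0 mulr0.
have lZ a x : l (a *: x) = a * l x by rewrite -[a *: x]addr0 lin l0 addr0.
have lN x : l (- x) = - l x by rewrite -scaleN1r lZ mulN1r.
have lD x y : l (x + y) = l x + l y by rewrite -[x]scale1r lin mul1r scale1r.
pose J x := `|x| ^+ 2 - 2 * l x.
have Jlb x : - B ^+ 2 <= J x.
  have := bnd x; rewrite ler_norml => /andP[_ h].
  have := sqr_ge0 (`|x| - B); rewrite sqrrB /J; lra.
pose m := inf (range J).
have hinf : has_inf (range J).
  by split; [exists (J 0), 0|exists (- B ^+ 2) => _ [x _ <-]].
have mJ x : m <= J x by apply: ge_inf; [case: hinf|exists x].
have /choice[xn xnP] : forall n : nat, exists x, J x < m + n.+1%:R^-1.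
  move=> n; have [|_ [x _ <-] h] := @inf_adherent R (range J) n.+1%:R^-1 _ hinf.
    by rewrite invr_gt0.
  by exists x.
have close x y d : J x < m + d -> J y < m + d -> `|x - y| ^+ 2 <= 4 * d.
  move=> Jx Jy; have := parallelogram x y.
  have := mJ (2^-1 *: (x + y)); rewrite /J lZ lD normrZ exprMn ger0_norm//.
  move: Jx Jy; rewrite /J => Jx Jy h1 h2.
  have -> : `|x - y| ^+ 2 = 2 * `|x| ^+ 2 + 2 * `|y| ^+ 2 - `|x + y| ^+ 2 by lra.
  have : 2^-1 ^+ 2 * `|x + y| ^+ 2 = 4^-1 * `|x + y| ^+ 2 by field.
  lra.
have cx : cvg (xn n @[n --> \oo]).
  apply/cauchy_cvgP; apply: cauchy_exP => e e0.
  have d0 : 0 < e ^+ 2 / 8 by rewrite divr_gt0// exprn_gt0.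
  have [N _ hN] : \forall n \near \oo, n.+1%:R^-1 < e ^+ 2 / 8 :> R.
    exact: near_infty_natSinv_lt (PosNum d0).
  exists (xn N); exists N => // n /= Nn.
  rewrite -ball_normE/= -ltr_sqr ?nnegrE ?normr_ge0 ?(ltW e0)//.
  have h k : (N <= k)%N -> J (xn k) < m + e ^+ 2 / 8.
    by move=> Nk; apply: (lt_trans (xnP k)); rewrite ltrD2l; exact: hN.
  have := close _ _ _ (h N (leqnn N)) (h n Nn).
  have : 0 < e ^+ 2 by exact: exprn_gt0.
  lra.
move: cx => /cvg_ex[/= x xnx].
have cl : l (xn n) @[n --> \oo] --> l x.
  apply/cvgrPdist_lt => e e0; near=> n.
  have -> : l x - l (xn n) = l (x - xn n).
    by rewrite lD lN.
  apply: (le_lt_trans (bnd _)).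
  apply: (@le_lt_trans _ _ ((`|B| + 1) * `|x - xn n|)).
    by apply: ler_wpM2r => //; rewrite (le_trans (ler_norm B))// lerDl.
  rewrite mulrC -ltr_pdivlMr ?ltr_wpDl//.
  near: n; apply: (@cvgr_dist_lt _ _ _ _ _ xn) => //.
  by rewrite divr_gt0// ltr_wpDl.
have Jx : J x <= m.
  have cJ : J (xn n) @[n --> \oo] --> J x.
    apply: cvgB; last by apply: cvgM => //; exact: cvg_cst.
    by rewrite /= expr2; apply: cvgM; exact: cvg_norm.
  have cm : m + n.+1%:R^-1 @[n --> \oo] --> m.
    by rewrite -[X in _ --> X]addr0; apply: cvgD; [exact: cvg_cst|exact: cvg_harmonic].
  by apply: (ler_cvg_to cJ cm); apply: nearW => n; exact: ltW.
exists x => u; apply/subr0_eq.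
set d := ip x u - l u.
pose k := `|u| ^+ 2 + 1.
have k0 : 0 < k by rewrite ltr_wpDl// exprn_ge0.
(* Unless d = 0, moving from x along - d u makes J smaller than its infimum. *)
have := le_trans Jx (mJ (x + (- (d / k)) *: u)).
rewrite /J normD_sqr lD lZ ipZr normrZ exprMn real_normK ?num_real// -subr_ge0.
have -> : `|x| ^+ 2 + (- (d / k) * ip x u) *+ 2 + (- (d / k)) ^+ 2 * `|u| ^+ 2 -
    2 * (l x + - (d / k) * l u) - (`|x| ^+ 2 - 2 * l x) = - (d ^+ 2 * (k + 1) / k ^+ 2).
  have -> : `|u| ^+ 2 = k - 1 by rewrite /k addrK.
  have -> : ip x u = d + l u by rewrite /d subrK.
  by field; rewrite gt_eqF.
rewrite oppr_ge0 => h; apply/eqP; rewrite -sqrf_eq0 eq_le sqr_ge0 andbT.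
by move: h; rewrite pmulr_lle0 ?invr_gt0 ?exprn_gt0// pmulr_lle0// addr_gt0.
Unshelve. all: by end_near. Qed.

(** A compact segment provides a cluster point, and an ultrafilter converges to
    each of its cluster points. *)
Lemma ultra_bounded_cvg {T : Type} (G : set_system T) (f : T -> R) (B : R) :
  UltraFilter G -> (\forall s \near G, `|f s| <= B) -> exists r : R, f s @[s --> G] --> r.
Proof.
move=> GU fB.
have := @segment_compact R (- B) B (f @ G) _.
case=> [|p [_ clp]].
  by rewrite /fmap/=; near=> s; rewrite /= in_itv/= -ler_norml; near: s.
exists p => A Ap.
have [//|GA] := in_ultra_setVsetC (f @^-1` A) GU.
have [] := clp (~` A) A GA Ap.
by move=> r [].
Unshelve. all: by end_near. Qed.

(** Weak compactness of balls in the form needed here: the limits of the numbers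
    <y, u> depend linearly and boundedly on u, so a vector represents them. *)
Lemma ultra_weak_limit (G : set_system R) (y : R -> H) (B : R) :
  UltraFilter G -> (\forall s \near G, `|y s| <= B) ->
  exists x, forall u, ip (y s) u @[s --> G] --> ip x u.
Proof.
move=> GU yB.
have /choice[l lP] : forall u, exists r : R, ip (y s) u @[s --> G] --> r.
  move=> u; apply: (ultra_bounded_cvg G _ (B * `|u|)) => //; near=> s.
  apply: (le_trans (norm_ip_le _ _)); apply: ler_wpM2r => //; near: s; exact: yB.
have [||x xl] := riesz_representation l B.
- move=> a u w; apply: (cvg_unique _ (lP (a *: u + w))) => //.
  have -> : (fun s => ip (y s) (a *: u + w)) = (fun s => a * ip (y s) u + ip (y s) w).
    by apply/funext => s; rewrite ipDr ipZr.
  by apply: cvgD => //; apply: cvgM => //; exact: cvg_cst.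
- move=> u; apply: (@ler_cvg_to _ G _ R (fun s => `|ip (y s) u|) (fun=> B * `|u|)).
  + by apply: cvg_norm; exact: lP.
  + exact: cvg_cst.
  near=> s.
  apply: (le_trans (norm_ip_le _ _)); apply: ler_wpM2r => //; near: s; exact: yB.
by exists x => u; rewrite xl.
Unshelve. all: by end_near. Qed.

(** Weak limits exist along ultrafilters, and the hypotheses put them in S. Two
    of them, x and x', are equal: |y - x|^2 - |y - x'|^2 converges and is, up to a
    constant, twice <y, x' - x>, which therefore has the same limit along both
    ultrafilters, that is <x, x' - x> = <x', x' - x>. If the weak convergence to
    x failed, an ultrafilter living off a neighbourhood of the limit would produce
    a second weak limit. *)
Lemma opial (S : set H) (y : R -> H) : S !=set0 ->
  (forall z, S z -> exists l : R, `|y s - z| ^+ 2 @[s --> +oo] --> l) ->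
  (forall (G : set_system R) (B : R) x, UltraFilter G -> pinfty_nbhs R `<=` G ->
    (\forall s \near G, `|y s| <= B) ->
    (forall u, ip (y s) u @[s --> G] --> ip x u) -> S x) ->
  exists2 x, S x & weakly_cvg ip y x.
Proof.
move=> [z0 Sz0] distS clS.
have [l0 hl0] := distS _ Sz0.
have [B yB] : exists B : R, \forall s \near +oo, `|y s| <= B.
  exists (`|z0| + (l0 + 1 + 1)); near=> s.
  rewrite -[y s](subrK z0) addrC; apply: (le_trans (ler_normD _ _)); apply: lerD => //.
  apply: (@le_trans _ _ (`|y s - z0| ^+ 2 + 1)).
    have := sqr_ge0 (`|y s - z0| - 1); have := sqr_ge0 (`|y s - z0|).
    rewrite sqrrB1; lra.
  by apply: lerD => //; near: s; apply: cvgr_le hl0 _ _; rewrite ltrDl.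
have limG (G : set_system R) : UltraFilter G -> pinfty_nbhs R `<=` G ->
    exists x, S x /\ forall u, ip (y s) u @[s --> G] --> ip x u.
  move=> GU GR; have [x hx] := ultra_weak_limit G y B GU (GR _ yB).
  by exists x; split => //; exact: (clS G B x GU GR (GR _ yB)).
have uniqG (G G' : set_system R) x x' : UltraFilter G -> UltraFilter G' ->
    pinfty_nbhs R `<=` G -> pinfty_nbhs R `<=` G' -> S x -> S x' ->
    (forall u, ip (y s) u @[s --> G] --> ip x u) ->
    (forall u, ip (y s) u @[s --> G'] --> ip x' u) -> x' = x.
  move=> GU GU' GR GR' Sx Sx' hx hx'.
  have [l hl] := distS _ Sx; have [l' hl'] := distS _ Sx'.
  have [k hk] : exists k : R, ip (y s) (x' - x) @[s --> +oo] --> k.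
    exists (2^-1 * ((l - l') + (`|x'| ^+ 2 - `|x| ^+ 2))).
    have -> : (fun s => ip (y s) (x' - x)) =
        (fun s => 2^-1 * ((`|y s - x| ^+ 2 - `|y s - x'| ^+ 2) + (`|x'| ^+ 2 - `|x| ^+ 2))).
      apply/funext => s; rewrite !normB_sqr ipDr ipNr; lra.
    apply: cvgM; first exact: cvg_cst.
    by apply: cvgD; [exact: cvgB|exact: cvg_cst].
  have e1 : ip x (x' - x) = k.
    apply: (cvg_unique _ (hx (x' - x))) => //.
    by move=> A /hk; exact: GR.
  have e2 : ip x' (x' - x) = k.
    apply: (cvg_unique _ (hx' (x' - x))) => //.
    by move=> A /hk; exact: GR'.
  apply/subr0_eq/eqP; rewrite -normr_eq0 -sqrf_eq0 -ip_norm.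
  by rewrite ipDl ipNl e1 e2 subrr.
have [G [GU GR]] := ultraFilterLemma (@proper_pinfty_nbhs R).
have [x [Sx hx]] := limG G GU GR.
exists x => // u A Ax.
apply: contrapT => nA.
pose D := ~` ((fun s => ip (y s) u) @^-1` A).
have PD : ProperFilter (within D (pinfty_nbhs R)).
  apply: Build_ProperFilter => /=; rewrite /within /= => h; apply: nA.
  by apply: filterS h => s /= h; apply: contrapT.
have [G' [GU' GR'']] := ultraFilterLemma PD.
have GR' : pinfty_nbhs R `<=` G'.
  by move=> E hE; apply: GR''; apply: filterS hE => s.
have [x' [Sx' hx']] := limG G' GU' GR'.
have xx' := uniqG _ _ _ _ GU GU' GR GR' Sx Sx' hx hx'.
have GA : G' ((fun s => ip (y s) u) @^-1` A) by apply: hx'; rewrite xx'.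
have GD : G' D by apply: GR''; rewrite /within/=; apply: nearW.
have GAD : G' ((fun s => ip (y s) u) @^-1` A `&` D) by exact: filterI.
by have [s []] := filter_ex GAD.
Unshelve. all: by end_near. Qed.

(** * Cocoercive operators *)

Section Cocoercive.
Context (M : H -> H) (rho : R).
Hypothesis rho_gt0 : 0 < rho.
Hypothesis M_coco :
  forall x y : H, rho * `|M x - M y| ^+ 2 <= ip (M x - M y) (x - y).

Lemma cocoercive_lipschitz (x y : H) : `|M x - M y| <= rho^-1 * `|x - y|.
Proof.
have [->|n0] := eqVneq (M x - M y) 0.
  by rewrite normr0 mulr_ge0// invr_ge0 ltW.
rewrite -(ler_pM2l rho_gt0) mulrA divff ?gt_eqF// mul1r.
rewrite -(ler_pM2r (_ : 0 < `|M x - M y|)) ?normr_gt0// -mulrA -expr2.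
by apply: (le_trans (M_coco x y)); rewrite mulrC ip_le.
Qed.

Lemma cocoercive_continuous x : {for x, continuous M}.
Proof.
apply/cvgrPdist_lt => e e0; near=> z.
apply: (le_lt_trans (cocoercive_lipschitz _ _)).
rewrite mulrC ltr_pdivrMr//; near: z.
by apply: (@cvgr_dist_lt _ _ _ _ _ id); [exact: cvg_id|rewrite mulr_gt0].
Unshelve. all: by end_near. Qed.

(** In the limit along G, cocoercivity between y s and x becomes
    rho |M x|^2 <= 0: the weak limit suffices on the right, because M (y s)
    converges strongly and y stays bounded. *)
Lemma cocoercive_demiclosed (G : set_system R) (y : R -> H) (B : R) x :
  ProperFilter G -> (\forall s \near G, `|y s| <= B) ->
  M (y s) @[s --> G] --> (0 : H) ->
  (forall u, ip (y s) u @[s --> G] --> ip x u) -> M x = 0.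
Proof.
move=> GP yB Mu yx.
have lhs : rho * ip (M (y s) - M x) (M (y s) - M x) @[s --> G] -->
    rho * ip (0 - M x) (0 - M x).
  by apply: cvgM; [exact: cvg_cst|]; apply: cvg_ip; apply: cvgB => //; exact: cvg_cst.
have u0 : ip (M (y s)) (y s - x) @[s --> G] --> (0 : R).
  have ub : `|M (y s)| * (B + `|x|) @[s --> G] --> (0 : R).
    rewrite -(mul0r (B + `|x|)) -(normr0 H); apply: cvgM; last exact: cvg_cst.
    exact: cvg_norm.
  apply: norm_cvg0; apply: (squeeze_cvgr (f := cst 0) _ _ ub); last exact: cvg_cst.
  near=> s; rewrite normr_ge0/=; apply: (le_trans (norm_ip_le _ _)).
  apply: ler_wpM2l => //; apply: (le_trans (ler_normB _ _)); apply: lerD => //.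
  by near: s.
have rhs : ip (M (y s) - M x) (y s - x) @[s --> G] --> (0 - (ip x (M x) - ip x (M x)) : R).
  have -> : (fun s => ip (M (y s) - M x) (y s - x)) =
      (fun s => ip (M (y s)) (y s - x) - (ip (y s) (M x) - ip x (M x))).
    by apply/funext => s; rewrite [in LHS]ipDl ipNl (ipC (M x)) [in LHS](ipDl _ _ (M x)) ipNl.
  by apply: cvgB => //; apply: cvgB; [exact: yx|exact: cvg_cst].
have := @ler_cvg_to R G _ R _ _ _ _ lhs rhs _.
rewrite subrr subr0 ip_norm sub0r normrN => h.
apply/normr0_eq0/eqP; rewrite -sqrf_eq0 eq_le sqr_ge0 andbT -(pmulr_rle0 _ rho_gt0).
by apply: h; apply: nearW => s; rewrite ip_norm; exact: M_coco.
Unshelve. all: by end_near. Qed.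

(** Cocoercivity between y (s + h) and y s, divided by h^2, in the limit h = 0. *)
Lemma cocoercive_derive (y : R -> H) (s : R) (b w : H) : is_derive s 1 y b ->
  is_derive s 1 (M \o y) w -> rho * `|w| ^+ 2 <= ip w b.
Proof.
move=> dys dw.
have qy : (fun h => h^-1 *: (y (h *: 1 + s) - y s)) @ 0^' --> b.
  by case: dys => df <-; exact: df.
have qw : (fun h => h^-1 *: (M (y (h *: 1 + s)) - M (y s))) @ 0^' --> w.
  by case: dw => df <-; exact: df.
have lw : (fun h : R => rho * ip (h^-1 *: (M (y (h *: 1 + s)) - M (y s)))
     (h^-1 *: (M (y (h *: 1 + s)) - M (y s)))) @ 0^' --> rho * ip w w.
  by apply: cvgM; [exact: cvg_cst|exact: cvg_ip].
have lb : (fun h : R => ip (h^-1 *: (M (y (h *: 1 + s)) - M (y s)))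
     (h^-1 *: (y (h *: 1 + s) - y s)) : R) @ 0^' --> ip w b.
  exact: cvg_ip.
rewrite -ip_norm; apply: (ler_cvg_to lw lb); near=> h.
rewrite !ipZl !ipZr ip_norm.
have := ler_wpM2l (sqr_ge0 h^-1) (M_coco (y (h *: 1 + s)) (y s)).
congr (_ <= _); ring.
Unshelve. all: by end_near. Qed.

Section Trajectory.
Context (s0 : R) (y v : R -> H).
Hypothesis s0_gt0 : 0 < s0.
Hypothesis yv : C1_half_line s0 y v.

Lemma y_derive s : s0 < s -> is_derive s 1 y (v s).
Proof. by case: yv => h _ _; exact: h. Qed.

Lemma v_continuous s : s0 < s -> {for s, continuous v}.
Proof.
case: yv => _ _ /continuous_within_itvcyP[cv _] ss0.
by apply: cv; rewrite in_itv/= ss0.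
Qed.

Lemma y_continuous s : s0 < s -> {for s, continuous y}.
Proof. by move=> /y_derive; exact: is_derive_continuous. Qed.

Lemma residual_continuous s : s0 < s -> {for s, continuous (M \o y)}.
Proof.
by move=> /y_continuous cy; apply: continuous_comp => //; exact: cocoercive_continuous.
Qed.

Lemma residual_lipschitz a b : s0 < a -> a <= b -> exists2 K, 0 <= K &
  forall l r, a <= l -> l <= r -> r <= b -> `|M (y r) - M (y l)| <= K * (r - l).
Proof.
move=> s0a ab; have [|B vB] := @segment_bounded R _ a b v ab.
  by move=> s as_ _; apply: v_continuous; exact: lt_le_trans as_.
have B0 : 0 <= B by apply: le_trans (vB a (lexx a) ab).
exists (rho^-1 * B); first by rewrite mulr_ge0// invr_ge0 ltW.
move=> l r al lr rb; apply: (le_trans (cocoercive_lipschitz _ _)).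
rewrite -mulrA ler_pM2l ?invr_gt0//.
apply: (is_derive_lipschitz_ip a b B y v) => // s as_ _.
by apply: y_derive; exact: lt_le_trans as_.
Qed.

(** Quantifying over the filter lets one proof treat both the two-sided limits at
    interior points and the right limit at the endpoint s0. *)
Lemma half_line_continuous (f : R -> R) :
  (forall (F : set_system R) (FF : Filter F) (s : R), 0 < s -> F `=>` nbhs s ->
    y @ F --> y s -> v @ F --> v s -> f @ F --> f s) ->
  {in `]s0, +oo[, continuous f} /\ f x @[x --> s0^'+] --> f s0.
Proof.
move=> hf; case: yv => _ y0 /continuous_within_itvcyP[_ v0]; split => [s|].
  rewrite in_itv/= andbT => ss0; apply: hf => //.
  - exact: lt_trans ss0.
  - exact: y_continuous.
  - exact: v_continuous.
apply: hf => //; last exact: is_derive_right_cvg y0.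
exact: cvg_within.
Qed.

(** * Integrating the equation once *)

Section FirstIntegral.
Context (alpha : R).
Hypothesis alpha_gt1 : 1 < alpha.
Hypothesis ac_v : loc_abs_continuous s0 v.
Hypothesis ode : {ae (@lebesgue_measure R), forall s : R, s0 < s ->
  exists a w : H,
  [/\ is_derive s 1 v a,
      is_derive s 1 (M \o y) w
    & a + (alpha / s) *: v s + (s / (alpha + 1)) *: w + M (y s) = 0]}.

Let c := (alpha + 1)^-1.

(** The component along h of s^alpha (y' + c s M(y)). Working with real-valued
    components makes the monotonicity criterion for real functions applicable. *)
Let flux h (s : R) : R := s `^ alpha * (ip (v s) h + c * (s * ip (M (y s)) h)).

Lemma flux_abs_continuous h a b : s0 < a -> a <= b -> abs_continuous a b (flux h).
Proof.
move=> s0a ab.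
have a0 : 0 < a by exact: lt_trans s0a.
have sb (V : normedModType R) (f : R -> V) (cf : forall s, s0 < s -> {for s, continuous f}) :
    exists B : R, forall s, a <= s -> s <= b -> `|f s| <= B.
  apply: segment_bounded => // s as_ _; apply: cf; exact: lt_le_trans as_.
have bip (f : R -> H) (cf : forall s, s0 < s -> {for s, continuous f}) :
    exists B : R, forall s, a <= s -> s <= b -> `|ip (f s) h| <= B.
  have [B hB] := sb _ f cf; exists (B * `|h|) => s as_ sb'.
  by apply: (le_trans (norm_ip_le _ _)); apply: ler_wpM2r => //; exact: hB.
have [B1 vB] := bip _ v_continuous.
have [B2 MB] := bip _ residual_continuous.
have acM_ : abs_continuous a b (fun s => ip (M (y s)) h).
  apply: abs_continuous_ip; have [K K0 MK] := residual_lipschitz a b s0a ab.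
  exact: (lipschitz_abs_continuous a b K _ K0 MK).
have [B3 pB] : exists B : R, forall s, a <= s -> s <= b -> `|s `^ alpha| <= B.
  apply: (sb R) => s ss0; apply: is_derive_continuous.
  by apply: is_derive1_powR; exact: lt_trans ss0.
have acp : abs_continuous a b (fun s : R => s `^ alpha).
  by have [K K0 pK] := powR_lipschitz alpha a b a0 ab;
    exact: (lipschitz_abs_continuous a b K _ K0 pK).
have idB s : a <= s -> s <= b -> `|id s| <= b.
  by move=> as_ sb'; rewrite ger0_norm// (le_trans _ as_)// ltW.
have acsM : abs_continuous a b (fun s => s * ip (M (y s)) h).
  by apply: (abs_continuousM a b b B2) => //; exact: abs_continuous_id.
have accst : abs_continuous a b (fun=> c : R).
  by apply: (@lipschitz_abs_continuous _ _ _ _ 0) => // *; rewrite subrr normr0 mul0r.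
have sMB s : a <= s -> s <= b -> `|s * ip (M (y s)) h| <= b * B2.
  by move=> as_ sb'; rewrite normrM; apply: ler_pM => //; [exact: idB|exact: MB].
have cB s : a <= s -> s <= b -> `|c| <= `|c| by [].
apply: (@abs_continuousM _ _ _ B3 (B1 + `|c| * (b * B2))) => //.
  move=> s as_ sb'; apply: (le_trans (ler_normD _ _)); apply: lerD; first exact: vB.
  by rewrite normrM; apply: ler_wpM2l => //; exact: sMB.
apply: abs_continuousD; first by apply: abs_continuous_ip; apply: ac_v; exact: ltW.
exact: (abs_continuousM a b `|c| (b * B2)).
Qed.

(** The derivative is s^alpha times the component of the left-hand side of the
    equation, because c (alpha + 1) = 1. *)
Lemma flux_derive0 h (s : R) a w : s0 < s ->
  is_derive s 1 v a -> is_derive s 1 (M \o y) w ->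
  a + (alpha / s) *: v s + (s / (alpha + 1)) *: w + M (y s) = 0 ->
  is_derive s 1 (flux h) 0.
Proof.
move=> ss0 da dw eq0.
have sgt0 : 0 < s by exact: lt_trans ss0.
have : is_derive s 1 (flux h)
  (alpha * s `^ (alpha - 1) * (ip (v s) h + c * (s * ip (M (y s)) h))
   + s `^ alpha * (ip a h + c * (1 * ip (M (y s)) h + s * ip w h))).
  apply: is_derive_mul; first exact: is_derive1_powR.
  apply: is_derive_add; first exact: is_derive_ip_cst.
  by apply: is_derive_mul_cst; apply: is_derive_mul; exact: is_derive_ip_cst dw.
congr is_derive.
have -> : s `^ (alpha - 1) = s `^ alpha / s.
  by rewrite powRB ?powRr1 ?ltW// gt_eqF// implybT.
have : ip (a + (alpha / s) *: v s + (s / (alpha + 1)) *: w + M (y s)) h = 0.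
  by rewrite eq0 ipC ip0r.
rewrite !(ipDl, ipZl) -!addrA => /eqP; rewrite addr_eq0 => /eqP ->.
rewrite /c; field.
by rewrite !gt_eqF//; move: alpha_gt1; lra.
Qed.

Lemma flux_derive0_ae h :
  {ae (@lebesgue_measure R), forall s, s0 < s -> is_derive s 1 (flux h) 0}.
Proof.
case: ode => N [mN N0 sN]; exists N; split => // s ns; apply: sN => hs; apply: ns => /= ss0.
by have [a [w [da dw eq0]]] := hs ss0; exact: flux_derive0 da dw eq0.
Qed.

(** Monotonicity in the direction h and in the direction - h. *)
Lemma flux_constant h a b : s0 < a -> a <= b -> flux h b = flux h a.
Proof.
move=> s0a ab.
have mono h' : flux h' b <= flux h' a.
  apply: abs_continuous_ae_nonincreasing => //; first exact: flux_abs_continuous.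
  case: (flux_derive0_ae h') => N [mN N0 sN]; exists N; split => // s ns.
  apply: sN => hs; apply: ns => /= as_ _.
  by exists 0 => //; apply: hs; exact: lt_trans as_.
apply/le_anti; rewrite mono/= -lerN2.
have gN s : - flux h s = flux (- h) s by rewrite /flux !ipNr; ring.
by rewrite !gN mono.
Qed.

Lemma first_integral : exists C : H, forall s, s0 < s ->
  v s = s `^ (- alpha) *: C - (c * s) *: M (y s).
Proof.
pose P s := s `^ alpha *: (v s + (c * s) *: M (y s)).
have Pg h s : ip (P s) h = flux h s.
  by rewrite /P ipZl ipDl ipZl /flux; ring.
have Pcst a b : s0 < a -> a <= b -> P b = P a.
  move=> s0a ab; apply/subr0_eq/eqP; rewrite -normr_eq0 -sqrf_eq0 -ip_norm.
  by rewrite {1}ipDl ipNl !Pg (flux_constant _ a b)// subrr.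
exists (P (s0 + 1)) => s ss0.
have -> : P (s0 + 1) = P s.
  have s1 : s0 < s0 + 1 by rewrite ltrDl.
  by have [h|/ltW h] := leP s (s0 + 1); [|apply/esym]; exact: Pcst.
have sgt0 : 0 < s by exact: lt_trans ss0.
rewrite /P scalerA powRN mulVf ?scale1r ?addrK// gt_eqF// powR_gt0//.
Qed.

End FirstIntegral.

(** * A Lyapunov function *)

Section PerturbedDescent.
Context (alpha c : R) (C : H).
Hypothesis alpha_gt1 : 1 < alpha.
Hypothesis c_gt0 : 0 < c.
Hypothesis vE : forall s, s0 < s ->
  v s = s `^ (- alpha) *: C - (c * s) *: M (y s).

(** The primitive of - |C| s^(-alpha) that vanishes at infinity. *)
Definition theta (s : R) : R := `|C| / (alpha - 1) * s `^ (1 - alpha).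

(** The perturbation contributes at most 2 s^(-alpha) |C| |y - z| to the derivative
    of |y - z|^2, hence at most |C| s^(-alpha) (1 + |y - z|^2); this is why 1 is
    added to the squared distance and why the weight is the exponential of
    theta. *)
Definition lyapunov z (s : R) : R := (1 + `|y s - z| ^+ 2) * expR (theta s).

Definition dlyapunov z (s : R) : R :=
  expR (theta s) * (2 * ip (v s) (y s - z) - `|C| * s `^ (- alpha) * (1 + `|y s - z| ^+ 2)).

Lemma theta_ge0 s : 0 <= theta s.
Proof.
by rewrite mulr_ge0 ?powR_ge0// divr_ge0// subr_ge0 ltW.
Qed.

Lemma theta_cvg0 : theta s @[s --> +oo] --> (0 : R).
Proof.
rewrite -(mulr0 (`|C| / (alpha - 1))); apply: cvgM; first exact: cvg_cst.
by rewrite -opprB; apply: powRN_cvg0; rewrite subr_gt0.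
Qed.

Lemma lyapunov_derive z s : s0 < s -> is_derive s 1 (lyapunov z) (dlyapunov z s).
Proof.
move=> ss0; have sgt0 : 0 < s by exact: lt_trans ss0.
have dtheta : is_derive s 1 theta (`|C| / (alpha - 1) * ((1 - alpha) * s `^ (1 - alpha - 1))).
  by apply: is_derive_mul_cst; exact: is_derive1_powR.
have dyz : is_derive s 1 (fun s => y s - z) (v s).
  rewrite -[v s]subr0; apply: is_deriveB; first exact: y_derive.
have dq := is_derive_ip _ _ _ _ _ dyz dyz.
have -> : lyapunov z = fun s => (1 + ip (y s - z) (y s - z)) * (expR \o theta) s.
  by apply/funext => t; rewrite /lyapunov ip_norm.
have d1 : is_derive s (1 : R) (fun=> 1 : R) (0 : R) by exact: is_derive_cst.
have := is_derive_mul _ _ _ _ _ (is_derive_add _ _ _ _ _ d1 dq)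
   (is_derive1_comp (is_derive_expR (theta s)) dtheta).
congr is_derive.
rewrite /dlyapunov /= (ipC _ (v s)) ip_norm (_ : 1 - alpha - 1 = - alpha); last by ring.
by field; rewrite gt_eqF// subr_gt0.
Qed.

(** Besides cocoercivity, the bound uses 2 |y - z| <= 1 + |y - z|^2 to make the
    terms in C cancel, and exp(theta) >= 1 to drop the weight. *)
Lemma dlyapunov_le z s : M z = 0 -> s0 < s ->
  dlyapunov z s <= - (2 * c * rho * (s * `|M (y s)| ^+ 2)).
Proof.
move=> Mz ss0; have sgt0 : 0 < s by exact: lt_trans ss0.
set k := 2 * c * rho * _.
have k0 : 0 <= k by rewrite /k !mulr_ge0 ?exprn_ge0// ltW.
suff inner : 2 * ip (v s) (y s - z) - `|C| * s `^ (- alpha) * (1 + `|y s - z| ^+ 2) <= - k.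
  apply: (@le_trans _ _ (expR (theta s) * - k)).
    by rewrite ler_pM2l// expR_gt0.
  by rewrite mulrN lerN2 ler_peMl// -expR0 ler_expR theta_ge0.
rewrite vE// ipDl ipNl !ipZl.
have coco : rho * `|M (y s)| ^+ 2 <= ip (M (y s)) (y s - z).
  by have := M_coco (y s) z; rewrite Mz subr0.
have P0 : 0 <= s `^ (- alpha) by exact: powR_ge0.
have CS : ip C (y s - z) <= `|C| * `|y s - z| by exact: ip_le.
have amgm : 2 * `|y s - z| <= 1 + `|y s - z| ^+ 2.
  by have := sqr_ge0 (`|y s - z| - 1); rewrite sqrrB1 -subr_ge0; lra.
have h1 : s `^ (- alpha) * (2 * ip C (y s - z)) <=
    s `^ (- alpha) * (`|C| * (1 + `|y s - z| ^+ 2)).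
  apply: ler_wpM2l => //; apply: (@le_trans _ _ (`|C| * (2 * `|y s - z|))); first lra.
  exact: ler_wpM2l.
have h2 : c * s * (rho * `|M (y s)| ^+ 2) <= c * s * ip (M (y s)) (y s - z).
  by apply: ler_wpM2l => //; rewrite mulr_ge0// ltW.
rewrite /k; lra.
Qed.

Lemma lyapunov_ge0 z s : 0 <= lyapunov z s.
Proof. by rewrite mulr_ge0 ?expR_ge0// addr_ge0. Qed.

(** The mean value theorem locates a point where the residual is controlled by the
    decrease of the Lyapunov function. *)
Lemma lyapunov_drop z s t : M z = 0 -> s0 < s -> s < t ->
  exists2 x, s < x < t &
   2 * c * rho * (x * `|M (y x)| ^+ 2) * (t - s) <= lyapunov z s - lyapunov z t.
Proof.
move=> Mz ss0 st.
have dl x : s <= x -> is_derive x 1 (lyapunov z) (dlyapunov z x).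
  by move=> sx; apply: lyapunov_derive; exact: lt_le_trans sx.
have [||x] := @MVT R (lyapunov z) (dlyapunov z) s t st.
- by move=> x; rewrite in_itv/= => /andP[/ltW sx _]; exact: dl.
- apply: continuous_in_subspaceT => x; rewrite inE/= in_itv/= => /andP[sx _].
  by apply: is_derive_continuous; exact: dl.
rewrite in_itv/= => /andP[sx xt] E; exists x; first by rewrite sx.
rewrite -[leRHS]opprB E -mulNr ler_pM2r ?subr_gt0// lerNr; apply: dlyapunov_le => //.
exact: lt_trans sx.
Qed.

Lemma lyapunov_nonincreasing z s t : M z = 0 -> s0 < s -> s <= t ->
  lyapunov z t <= lyapunov z s.
Proof.
move=> Mz ss0; rewrite le_eqVlt => /predU1P[->//|st].
have [x /andP[sx xt]] := lyapunov_drop _ _ _ Mz ss0 st.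
rewrite -[lyapunov z t <= _]subr_ge0; apply: le_trans.
have x0 : 0 < x by rewrite (lt_trans s0_gt0)// (lt_trans ss0).
by rewrite !mulr_ge0 ?exprn_ge0 ?subr_ge0// ltW.
Qed.

Lemma lyapunov_cvg z : M z = 0 -> exists l : R, lyapunov z s @[s --> +oo] --> l.
Proof.
move=> Mz; apply: (nonincreasing_bounded_cvg s0 0) => [s t ss0 st|s _].
  exact: lyapunov_nonincreasing.
exact: lyapunov_ge0.
Qed.

(** The weight exp(theta) tends to 1, so it does not affect convergence. *)
Lemma sqr_dist_is_cvg z : M z = 0 -> exists l : R, `|y s - z| ^+ 2 @[s --> +oo] --> l.
Proof.
move=> /lyapunov_cvg[l hl].
have el : expR (- theta s) @[s --> +oo] --> (1 : R).
  have t0 : - theta s @[s --> +oo] --> (0 : R).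
    by rewrite -oppr0; apply: cvgN; exact: theta_cvg0.
  by rewrite -expR0; apply: cvg_comp t0 _; exact: continuous_expR.
exists (l * 1 - 1).
have -> : (fun s => `|y s - z| ^+ 2) = (fun s => lyapunov z s * expR (- theta s) - 1).
  apply/funext => s; rewrite /lyapunov -mulrA -expRD subrr expR0; ring.
by apply: cvgB; [exact: cvgM|exact: cvg_cst].
Qed.

(** * Decay of the residual *)

(** The constant left after maximizing a quadratic polynomial in |w| below. *)
Let D := `|C| ^+ 2 / (2 * rho * c).

(** Inserting the first-order equation in rho |w|^2 <= <w, y'> gives
    c s <M(y), w> <= s^(-alpha) |C| |w| - rho |w|^2, and the right-hand side is at
    most (s^(-alpha) |C|)^2 / (4 rho). The bound is stated with t < s in place of
    s, so as to be uniform to the right of t. *)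
Lemma residual_sqr_derive_le (t s : R) w : s0 < t -> t < s -> is_derive s 1 (M \o y) w ->
  2 * ip (M (y s)) w <= D * (t `^ (- alpha)) ^+ 2 / t.
Proof.
move=> s0t ts dw.
have ss0 : s0 < s by exact: lt_trans ts.
have t0 : 0 < t by exact: lt_trans s0t.
have s_gt0 : 0 < s by exact: lt_trans ts.
have dys : is_derive s 1 y (v s) by exact: y_derive.
have := cocoercive_derive _ _ _ _ dys dw.
rewrite vE// ipDr ipNr !ipZr (ipC w (M (y s))).
set P := s `^ (- alpha) => main.
have P0 : 0 <= P by exact: powR_ge0.
have PT : P <= t `^ (- alpha).
  rewrite /P !powRN lef_pV2 ?posrE ?powR_gt0//.
  apply: ge0_ler_powR; rewrite ?nnegrE ?ltW//; exact: lt_trans ltr01 alpha_gt1.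
have CS : ip w C <= `|w| * `|C| by exact: ip_le.
have h1 : c * s * ip (M (y s)) w <= P * (`|w| * `|C|) - rho * `|w| ^+ 2.
  have : P * ip w C <= P * (`|w| * `|C|) by exact: ler_wpM2l.
  lra.
(* Completing the square in |w|. *)
have h2 : 4 * rho * (P * (`|w| * `|C|) - rho * `|w| ^+ 2) <= P ^+ 2 * `|C| ^+ 2.
  have := sqr_ge0 (2 * rho * `|w| - P * `|C|); rewrite -subr_ge0 => h.
  rewrite -subr_ge0 (_ : _ - _ = (2 * rho * `|w| - P * `|C|) ^+ 2 - 0) //; ring.
have h3 : 4 * rho * (c * s * ip (M (y s)) w) <= P ^+ 2 * `|C| ^+ 2.
  apply: le_trans h2; rewrite ler_pM2l// mulr_gt0//.
have -> : 2 * ip (M (y s)) w = (4 * rho * (c * s * ip (M (y s)) w)) / (2 * rho * c * s).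
  by field; rewrite !gt_eqF.
have k0 : 0 < 2 * rho * c * s by rewrite !mulr_gt0.
rewrite ler_pdivrMr//; apply: (le_trans h3).
have -> : D * t `^ (- alpha) ^+ 2 / t * (2 * rho * c * s) =
   (t `^ (- alpha) ^+ 2 * `|C| ^+ 2) * (s / t).
  by rewrite /D; field; rewrite !gt_eqF.
apply: (@le_trans _ _ ((t `^ (- alpha) ^+ 2 * `|C| ^+ 2) * 1)).
  rewrite mulr1; apply: ler_wpM2r; first exact: exprn_ge0.
  by rewrite ler_sqr ?nnegrE ?powR_ge0.
apply: ler_wpM2l; first by rewrite mulr_ge0// exprn_ge0// powR_ge0.
by rewrite ler_pdivlMr// mul1r ltW.
Qed.

Hypothesis residual_ae_derivable : {ae (@lebesgue_measure R), forall s : R,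
  s0 < s -> exists w : H, is_derive s 1 (M \o y) w}.

Lemma residual_sqr_abs_continuous a b : s0 < a -> a <= b ->
  abs_continuous a b (fun s => `|M (y s)| ^+ 2).
Proof.
move=> s0a ab.
have [K K0 MK] := residual_lipschitz a b s0a ab.
have [|B hB] := @segment_bounded R _ a b (M \o y) ab.
  move=> s as_ _; apply: residual_continuous.
  exact: lt_le_trans as_.
have acu := lipschitz_abs_continuous a b K _ K0 MK.
have B0 : 0 <= B by apply: le_trans (hB a (lexx _) ab).
apply: (@abs_continuous_dominated _ _ _ _ a b (2 * B) 0 _
  (M \o y) (M \o y)) => // [|l r al lr rb].
  by rewrite mulr_ge0.
have -> : `|M (y r)| ^+ 2 - `|M (y l)| ^+ 2 = ip (M (y r) - M (y l)) (M (y r) + M (y l)).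
  rewrite -!ip_norm !(ipDl, ipDr, ipNl) (ipC (M (y l)) (M (y r))); ring.
apply: (le_trans (norm_ip_le _ _)); rewrite mul0r addr0 mulrC.
apply: ler_wpM2r => //; apply: (le_trans (ler_normD _ _)).
have := hB r (le_trans al lr) rb; have := hB l al (le_trans lr rb); rewrite /=; lra.
Qed.

Lemma residual_sqr_le (t xi s : R) : s0 < t -> t <= xi -> xi <= s ->
  `|M (y s)| ^+ 2 <= `|M (y xi)| ^+ 2 + D * (t `^ (- alpha)) ^+ 2 / t * (s - xi).
Proof.
move=> s0t txi xis.
set K := D * _ / t.
have s0xi : s0 < xi by exact: lt_le_trans txi.
pose g s := `|M (y s)| ^+ 2 + - K * s.
have : g s <= g xi.
  apply: abs_continuous_ae_nonincreasing => //.
    apply: abs_continuousD; first exact: residual_sqr_abs_continuous.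
    apply: (@abs_continuous_dominated _ _ _ _ xi s `|K| 0 _ id id) => //;
      try exact: abs_continuous_id.
    by move=> l r _ _ _; rewrite mul0r addr0 -mulrBr normrM normrN.
  have dg (x : R) w : xi < x -> is_derive x 1 (M \o y) w ->
      exists2 d : R, is_derive x 1 g d & d <= 0.
    move=> xix dw; exists (2 * ip (M (y x)) w + - K * 1).
      have dK := is_derive_mul_cst id x 1 (- K) (is_derive_id x 1).
      apply: is_derive_add dK.
      have -> : (fun s => `|M (y s)| ^+ 2) = (fun s => ip ((M \o y) s) ((M \o y) s)).
        by apply/funext => t'; rewrite ip_norm.
      have := is_derive_ip _ _ _ _ _ dw dw.
      by congr is_derive; rewrite (ipC w) /=; ring.
    rewrite mulr1 subr_le0; apply: residual_sqr_derive_le => //; exact: le_lt_trans xix.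
  case: residual_ae_derivable => N [mN N0 sN]; exists N; split => // x nx.
  apply: sN => hx; apply: nx => /= xix _.
  have [w dw] := hx (lt_trans s0xi xix); exact: dg dw.
rewrite /g; lra.
Qed.

(** With t = s/2, there is x in (t, s) with t^2 |M(y x)|^2 at most a multiple of the
    decrease of the Lyapunov function over [t, s], and going from x to s raises
    t^2 |M(y)|^2 by at most D t^(2 - 2 alpha). Both bounds tend to 0. *)
Lemma residual_sqr_decay z : M z = 0 -> (s ^+ 2 * `|M (y s)| ^+ 2) @[s --> +oo] --> (0 : R).
Proof.
move=> Mz.
have [l hl] := lyapunov_cvg z Mz.
set L := lyapunov z in hl.
have half : (fun s : R => s / 2) @ +oo --> +oo.
  by apply: gt0_cvgMly; [rewrite invr_gt0|exact: cvg_id].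
have hl2 : L (s / 2) @[s --> +oo] --> l by exact: (cvg_comp _ _ half hl).
have p0 : (s / 2) `^ (1 - alpha) @[s --> +oo] --> (0 : R).
  have := @powRN_cvg0 R (alpha - 1); rewrite opprB subr_gt0 => /(_ alpha_gt1) h.
  exact: (cvg_comp _ _ half h).
have ub : 4 * ((2 * c * rho)^-1 * (L (s / 2) - L s) + D * ((s / 2) `^ (1 - alpha)) ^+ 2)
    @[s --> +oo] --> (0 : R).
  have -> : (0 : R) = 4 * ((2 * c * rho)^-1 * (l - l) + D * (0 * 0)) by rewrite subrr; ring.
  apply: cvgM; first exact: cvg_cst.
  apply: cvgD; apply: cvgM; try exact: cvg_cst; first exact: cvgB.
  exact: cvgM.
apply: (squeeze_cvgr (f := cst 0) _ _ ub); last exact: cvg_cst.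
near=> s.
have s2 : s0 < s / 2.
  by rewrite ltr_pdivlMr//; near: s; apply: nbhs_pinfty_gt; exact: num_real.
set t := s / 2 in s2 *.
have t0 : 0 < t by exact: lt_trans s2.
have st : s = 2 * t by rewrite /t; field.
apply/andP; split; first by apply: mulr_ge0; exact: sqr_ge0.
have ts : t < s by rewrite st; lra.
have [x /andP[tx xs] drop] := lyapunov_drop z t s Mz s2 ts.
have N := residual_sqr_le t x s s2 (ltW tx) (ltW xs).
rewrite -/L in drop.
have D0 : 0 <= D by rewrite divr_ge0 ?exprn_ge0 ?mulr_ge0// ltW.
set Q := t `^ (- alpha) in N.
have -> : t `^ (1 - alpha) = t * Q.
  by rewrite powRD ?powRr1 ?ltW// (gt_eqF t0) implybT.
have crho : 0 < 2 * c * rho by rewrite !mulr_gt0.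
have e1 : t ^+ 2 * `|M (y x)| ^+ 2 <= (2 * c * rho)^-1 * (L t - L s).
  rewrite [leRHS]mulrC ler_pdivlMr//; apply: le_trans drop.
  have -> : 2 * c * rho * (x * `|M (y x)| ^+ 2) * (s - t) =
      (x * t) * `|M (y x)| ^+ 2 * (2 * c * rho).
    by rewrite {1}st; ring.
  rewrite ler_pM2r//; apply: ler_wpM2r; first exact: exprn_ge0.
  by rewrite expr2 ler_pM2r// ltW.
have e2 : t ^+ 2 * (D * Q ^+ 2 / t * (s - x)) <= D * (t * Q) ^+ 2.
  have -> : t ^+ 2 * (D * Q ^+ 2 / t * (s - x)) = D * Q ^+ 2 * t * (s - x).
    by field; rewrite gt_eqF.
  have -> : D * (t * Q) ^+ 2 = D * Q ^+ 2 * t * t by ring.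
  apply: ler_wpM2l; last by rewrite st; lra.
  by apply: (mulr_ge0 _ (ltW t0)); apply: (mulr_ge0 D0); exact: sqr_ge0.
have e3 := ler_wpM2l (sqr_ge0 t) N.
rewrite mulrDr in e3.
have -> : s ^+ 2 = 4 * t ^+ 2 by rewrite st; ring.
rewrite -[X in X <= _]mulrA; apply: ler_wpM2l => //; apply: (le_trans e3); exact: lerD.
Unshelve. all: by end_near. Qed.

Lemma residual_littleo z : M z = 0 ->
  (fun s : R => `|M (y s)|) =o_+oo (fun s : R => s^-1).
Proof.
move=> Mz; apply/eqoP => e e0; near=> s.
have sg0 : 0 < s by near: s; apply: nbhs_pinfty_gt; exact: num_real.
rewrite normr_id ger0_norm ?invr_ge0 ?(ltW sg0)// ler_pdivlMr//.
rewrite -ler_sqr ?nnegrE ?mulr_ge0 ?(ltW sg0) ?(ltW e0)// exprMn mulrC.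
near: s; apply: cvgr_le; [exact: residual_sqr_decay Mz|by rewrite exprn_gt0].
Unshelve. all: by end_near. Qed.

(** * Integrability of the residual *)

Section LimitsAtAPoint.
Context (F : set_system R) {FF : Filter F} (s : R).
Hypotheses (s_gt0 : 0 < s) (Fs : F `=>` nbhs s).
Hypotheses (ys : y @ F --> y s) (vs : v @ F --> v s).

Lemma exp_theta_continuous : expR (theta t) @[t --> F] --> expR (theta s).
Proof.
have h : theta t @[t --> F] --> theta s.
  apply: cvgM; first exact: cvg_cst.
  by apply: cvg_trans (powR_continuous _ _ s_gt0); exact: cvg_app.
by apply: cvg_comp h _; exact: continuous_expR.
Qed.

Lemma sqr_dist_continuous z : (1 + `|y t - z| ^+ 2) @[t --> F] --> 1 + `|y s - z| ^+ 2.
Proof.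
apply: cvgD; first exact: cvg_cst.
have h : `|y t - z| @[t --> F] --> `|y s - z|.
  by apply: cvg_norm; apply: cvgB => //; exact: cvg_cst.
by rewrite expr2; under eq_fun do rewrite expr2; exact: cvgM.
Qed.

Lemma lyapunov_continuous z : lyapunov z t @[t --> F] --> lyapunov z s.
Proof. by apply: cvgM; [exact: sqr_dist_continuous|exact: exp_theta_continuous]. Qed.

Lemma dlyapunov_continuous z : dlyapunov z t @[t --> F] --> dlyapunov z s.
Proof.
apply: cvgM; first exact: exp_theta_continuous.
apply: cvgB.
  apply: cvgM; first exact: cvg_cst.
  by apply: cvg_ip => //; apply: cvgB => //; exact: cvg_cst.
apply: cvgM; last exact: sqr_dist_continuous.
apply: cvgM; first exact: cvg_cst.
by apply: cvg_trans (powR_continuous _ _ s_gt0); exact: cvg_app.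
Qed.

Lemma residual_density_continuous : (t * `|M (y t)| ^+ 2) @[t --> F] --> s * `|M (y s)| ^+ 2.
Proof.
apply: cvgM; first exact: Fs.
have h : `|M (y t)| @[t --> F] --> `|M (y s)|.
  apply: cvg_norm; apply: cvg_comp ys _.
  exact: cocoercive_continuous.
by rewrite expr2; under eq_fun do rewrite expr2; exact: cvgM.
Qed.

End LimitsAtAPoint.

(** At s0 the inequality follows by taking right limits; integration over the
    closed half-line asks for it there. *)
Lemma dlyapunov_le_closed z s : M z = 0 -> s0 <= s ->
  dlyapunov z s <= - (2 * c * rho * (s * `|M (y s)| ^+ 2)).
Proof.
move=> Mz.
have dle t : s0 < t -> dlyapunov z t <= - (2 * c * rho * (t * `|M (y t)| ^+ 2)).
  move=> ts; exact: dlyapunov_le.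
rewrite le_eqVlt => /predU1P[<-|]; last exact: dle.
have [_ h1] := half_line_continuous _
  (fun F FF s s_gt0 Fs ys vs => @dlyapunov_continuous F FF s s_gt0 Fs ys vs z).
have [_ h2] := half_line_continuous _
  (fun F FF s s_gt0 Fs ys vs => @residual_density_continuous F FF s Fs ys).
apply: (@ler_cvg_to R s0^'+ _ R (fun s => dlyapunov z s)
   (fun s => - (2 * c * rho * (s * `|M (y s)| ^+ 2))) _ _ h1).
  by apply: cvgN; apply: cvgM => //; exact: cvg_cst.
by near=> t; apply: dle; near: t; exact: nbhs_right_gt.
Unshelve. all: by end_near. Qed.

(** The integrand is at most - k times the derivative of the Lyapunov function,
    which converges at infinity, so the fundamental theorem of calculus bounds
    the integral. *)
Lemma residual_integral_lty z : M z = 0 ->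
  (\int[@lebesgue_measure R]_(s in `[s0, +oo[%classic)
         (s * `|M (y s)| ^+ 2)%:E < +oo)%E.
Proof.
move=> Mz.
have [l hl] := lyapunov_cvg z Mz.
pose k := (2 * c * rho)^-1.
have k_gt0 : 0 < k by rewrite invr_gt0 !mulr_gt0.
have cdl := half_line_continuous _
  (fun F FF s s_gt0 Fs ys vs => @dlyapunov_continuous F FF s s_gt0 Fs ys vs z).
have cly := half_line_continuous _
  (fun F FF s s_gt0 Fs ys vs => @lyapunov_continuous F FF s s_gt0 Fs ys z).
have cn := half_line_continuous _
  (fun F FF s s_gt0 Fs ys vs => @residual_density_continuous F FF s Fs ys).
have cf : {within `[s0, +oo[, continuous (fun s => - k * dlyapunov z s)}.
  apply/continuous_within_itvcyP; case: cdl => c1 c2; split => [s /c1 h|].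
    by apply: cvgM; [exact: cvg_cst|exact: h].
  by apply: cvgM; [exact: cvg_cst|exact: c2].
have bnd s : s0 <= s -> s * `|M (y s)| ^+ 2 <= - k * dlyapunov z s.
  move=> s0s; have := dlyapunov_le_closed _ _ Mz s0s.
  rewrite lerNr mulrC -ler_pdivlMr ?mulr_gt0// => /le_trans; apply.
  by rewrite /k !mulNr mulrC.
have n0 s : s0 <= s -> 0 <= s * `|M (y s)| ^+ 2.
  by move=> s0s; rewrite mulr_ge0 ?exprn_ge0// (le_trans _ s0s)// ltW.
have meas (f : R -> R) : {within `[s0, +oo[, continuous f} ->
    measurable_fun `[s0, +oo[%classic (fun s => (f s)%:E).
  by move=> cf'; apply/measurable_EFinP; apply: subspace_continuous_measurable_fun.
apply: (@le_lt_trans _ _ (\int[@lebesgue_measure R]_(s in `[s0, +oo[%classic)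
  (- k * dlyapunov z s)%:E)%E).
  apply: ge0_le_integral => //.
  - by move=> s; rewrite /= in_itv/= andbT lee_fin; exact: n0.
  - by apply: meas; apply/continuous_within_itvcyP.
  - exact: meas.
  - by move=> s; rewrite /= in_itv/= andbT lee_fin; exact: bnd.
rewrite (@ge0_continuous_FTC2y R _ (fun s => - k * lyapunov z s) s0 (- k * l)) //.
- by rewrite -EFinB ltry.
- by move=> s s0s; apply: le_trans (bnd _ s0s); exact: n0.
- by apply: cvgM => //; exact: cvg_cst.
- move=> s ss0.
  have := is_derive_mul_cst _ _ _ (- k) (lyapunov_derive z s ss0).
  by case.
- by apply: cvgM; [exact: cvg_cst|case: cly].
- move=> s; rewrite in_itv/= andbT => ss0; rewrite derive1E.
  have := is_derive_mul_cst _ _ _ (- k) (lyapunov_derive z s ss0).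
  by case.
Qed.

End PerturbedDescent.

End Trajectory.

End Cocoercive.

End InnerProduct.

(** * Asymptotics of the trajectory *)

Theorem theorem12 (R : realType) (H : completeNormedModType R)
    (ip : {dot H for idfun}) (ip_norm : induces_norm ip)
    (M : H -> H) (M_cocoercive : cocoercive ip M)
    (Zer_neq0 : Zer M !=set0)
    (s0 alpha : R) (s0_gt0 : 0 < s0) (alpha_gt1 : 1 < alpha)
    (y : R -> H) (y_sol : solution_trajectory M alpha s0 y) :
  [/\ (fun s : R => `|M (y s)|) =o_+oo (fun s : R => s^-1),
      (\int[@lebesgue_measure R]_(s in `[s0, +oo[%classic)
         (s * `|M (y s)| ^+ 2)%:E < +oo)%E
    & exists2 x : H, x \in Zer M & weakly_cvg ip y x].
Proof.
case: M_cocoercive => rho rho_gt0 coco; case: Zer_neq0 => z0 Mz0.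
case: y_sol => v [yv acv ode].
have [C vE] := first_integral ip ip_norm M rho rho_gt0 coco s0 y v s0_gt0 yv
  alpha alpha_gt1 acv ode.
pose c := (alpha + 1)^-1.
have c_gt0 : 0 < c by rewrite invr_gt0 addr_gt0// (lt_trans ltr01).
have dM : {ae (@lebesgue_measure R), forall s : R, s0 < s ->
    exists w : H, is_derive s 1 (M \o y) w}.
  case: ode => N [mN N0 sN]; exists N; split => // s ns; apply: sN => hs; apply: ns => /= ss0.
  by have [a [w [_ dw _]]] := hs ss0; exists w.
have small : (fun s : R => `|M (y s)|) =o_+oo (fun s : R => s^-1).
  exact: (residual_littleo ip ip_norm M rho rho_gt0 coco s0 y v s0_gt0 yv
    alpha c C alpha_gt1 c_gt0 vE dM z0).
split => //.
  exact: (residual_integral_lty ip ip_norm M rho rho_gt0 coco s0 y v s0_gt0 yv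
    alpha c C alpha_gt1 c_gt0 vE z0).
have dist z : Zer M z -> exists l : R, `|y s - z| ^+ 2 @[s --> +oo] --> l.
  move=> Mz.
  exact: (sqr_dist_is_cvg ip ip_norm M rho rho_gt0 coco s0 y v s0_gt0 yv
    alpha c C alpha_gt1 c_gt0 vE).
have Mto0 : M (y s) @[s --> +oo] --> (0 : H).
  apply: norm_cvg0; apply/cvgr0Pnorm_le => e e0.
  move/eqoP: small => /(_ _ e0) h; near=> s.
  have s1 : 1 <= s by near: s; apply: nbhs_pinfty_ge; exact: num_real.
  have h1 : `|(`|M (y s)|)| <= e * `|s^-1| by near: s.
  apply: (le_trans h1); rewrite -[leRHS]mulr1; apply: ler_wpM2l; first exact: ltW.
  by rewrite normfV invf_le1 ?normr_gt0 ?gt_eqF//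
    ?(lt_le_trans ltr01)// (le_trans s1)// ler_norm.
have [|||x Sx wx] := opial ip ip_norm (Zer M) y; last by exists x => //; rewrite inE.
- by exists z0.
- exact: dist.
move=> G B x GU GR yB yx.
by apply: (cocoercive_demiclosed ip ip_norm M rho rho_gt0 coco G y B) => //;
  apply: cvg_trans Mto0; exact: cvg_app.
Unshelve. all: by end_near. Qed.
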